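(* Let $L_n^{d,\alpha}$ be a line hypergraph such that $d=2\alpha$. Then the non-zero graded Betti numbers of $R/I(L_n^{d,\alpha})$ occur only in degrees of the form $j\alpha$ with $2i\ge j$ (where $i$ is the homological degree), and for all such $i,j$ $$\beta_{i,j\alpha}(R/I(L_n^{d,\alpha}))=\binom{j-i}{2i-j}\binom{n+1-2j+2i}{j-i}+\binom{j-i-1}{2i-j}\binom{n+1-2j+2i}{j-i-1}.$$
   Context: A hypergraph $\mathcal H$ consists of a finite vertex set $\mathcal X(\mathcal H)$ and a finite collection $\mathcal E(\mathcal H)$ of non-empty subsets of it, called edges; it is $d$-uniform if every edge has cardinality $d$. All hypergraphs are simple: every edge has at least $2$ vertices and no edge is contained in another edge. The line hypergraph $L_n^{d,\alpha}$ is the $d$-uniform hypergraph with edges $E_1,\dots,E_n$ and vertex set $\bigcup_{i=1}^nE_i$ such that (i) for any $i\neq j$, $E_i\cap E_j\ne\emptyset$ if and only if $j=i-1$ or $j=i+1$; (ii) $|E_i\cap E_{i+1}|=\alpha$ for all $1\le i\le n-1$. $R$ is the polynomial ring over a field $k$ whose variables are indexed by the vertices; for a set $F$ of vertices, $x^F=\prod_{v\in F}x_v$. The edge ideal is $I(\mathcal H)=(x^E : E\in\mathcal E(\mathcal H))$. $\beta_{i,j}(M)=\dim_k\mathrm{Tor}_i^R(M,k)_j$ are the $\mathbb N$-graded Betti numbers. A binomial coefficient $\binom ab$ is $0$ unless $0\le b\le a$. *)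

(* Defs.v *)
From mathcomp Require Import all_boot all_order all_algebra.
From mathcomp Require Import mpoly.
From Stdlib Require Import ClassicalEpsilon.

Set Implicit Arguments.
Unset Strict Implicit.
Unset Printing Implicit Defensive.

Import GRing.Theory.
Local Open Scope ring_scope.

(* A hypergraph on the vertex set V is given by its set of edges. *)

Definition simple_hypergraph (V : finType) (H : {set {set V}}) : Prop :=
  (forall E, E \in H -> 2 <= #|E|)%N /\
  (forall E F, E \in H -> F \in H -> E \subset F -> E = F).

Definition uniform_hypergraph (V : finType) (d : nat) (H : {set {set V}}) : Prop :=
  forall E, E \in H -> #|E| = d.

(* The edges E_1, ..., E_n are indexed from 0.  At least one edge is required,
   since otherwise d and alpha are not constrained by H. *)
Definition line_hypergraph (V : finType) (n d alpha : nat) (H : {set {set V}})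
  : Prop :=
  [/\ (0 < n)%N, simple_hypergraph H, uniform_hypergraph d H &
      exists E : 'I_n -> {set V},
        [/\ injective E,
            H = [set E i | i : 'I_n],
            \bigcup_(i < n) E i = [set: V],
            (forall i j : 'I_n, i != j ->
               (E i :&: E j != set0 <->
                (j.+1 = i :> nat \/ j = i.+1 :> nat))) &
            (forall i j : 'I_n, j = i.+1 :> nat -> #|E i :&: E j| = alpha)]].

Definition vpoly (k : fieldType) (V : finType) : comNzRingType :=
  {mpoly k[#|V|]}.

Definition xprod (k : fieldType) (V : finType) (F : {set V}) : vpoly k V :=
  \prod_(v in F) 'X_(enum_rank v).

Definition edge_ideal (k : fieldType) (V : finType) (H : {set {set V}})
  (p : vpoly k V) : Prop :=
  exists c : {set V} -> vpoly k V, p = \sum_(E in H) c E * xprod k E.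

(* Graded free resolutions of R/I, for R = k[x_1, ..., x_m] and I an ideal of R:
     ... -> F_2 -> F_1 -> F_0 -> R/I -> 0.
   F_i is free of rank [rk i], with a basis whose a-th element has degree
   [gdeg i a]; its elements are row vectors and the maps act on the right.
   [diff i] is the map F_(i+1) -> F_i, and [aug] lists homogeneous
   representatives in R of the images in R/I of the basis of F_0.  *)
Record graded_free_resolution (k : fieldType) (m : nat)
    (I : {mpoly k[m]} -> Prop) : Type := GradedFreeResolution {
  rk : nat -> nat;
  gdeg : forall i, 'I_(rk i) -> nat;
  diff : forall i, 'M[{mpoly k[m]}]_(rk i.+1, rk i);
  aug : 'cV[{mpoly k[m]}]_(rk 0%N);
  diff_graded : forall i a b (u : 'X_{1..m}),
    u \in msupp (diff i a b) -> (mdeg u + gdeg b)%N = gdeg a;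
  aug_graded : forall a (u : 'X_{1..m}),
    u \in msupp (aug a ord0) -> mdeg u = gdeg a;
  aug_surjective : forall p, exists v : 'rV_(rk 0%N),
    I (p - (v *m aug) ord0 ord0);
  exact_at_0 : forall v : 'rV_(rk 0%N),
    I ((v *m aug) ord0 ord0) <-> exists w, v = w *m diff 0%N;
  exact_at_S : forall i (v : 'rV_(rk i.+1)),
    v *m diff i = 0 <-> exists w, v = w *m diff i.+1
}.

(* The complex F (x)_R k: reducing modulo the variables amounts to taking
   constant coefficients. *)
Definition diff_k (k : fieldType) (m : nat) (I : {mpoly k[m]} -> Prop)
  (F : graded_free_resolution I) (i : nat) : 'M[k]_(rk F i.+1, rk F i) :=
  map_mx (mcoeff 0%MM) (diff F i).

(* The row space of this matrix is the degree j component of F_i (x)_R k. *)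
Definition component (k : fieldType) (m : nat) (I : {mpoly k[m]} -> Prop)
  (F : graded_free_resolution I) (i j : nat) : 'M[k]_(rk F i) :=
  diag_mx (\row_a (gdeg a == j)%:R).

Definition cycles (k : fieldType) (m : nat) (I : {mpoly k[m]} -> Prop)
  (F : graded_free_resolution I) (i j : nat) : 'M[k]_(rk F i) :=
  match i return 'M[k]_(rk F i) with
  | 0 => component F 0 j
  | i'.+1 => (component F i'.+1 j :&: kermx (diff_k F i'))%MS
  end.

Definition boundaries (k : fieldType) (m : nat) (I : {mpoly k[m]} -> Prop)
  (F : graded_free_resolution I) (i j : nat) : 'M[k]_(rk F i.+1, rk F i) :=
  component F i.+1 j *m diff_k F i.

(* dim_k H_i(F (x)_R k)_j, as the dimension of a complement of the boundaries
   in the cycles *)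
Definition homology_dim (k : fieldType) (m : nat) (I : {mpoly k[m]} -> Prop)
  (F : graded_free_resolution I) (i j : nat) : nat :=
  \rank (cycles F i j :\: boundaries F i j)%MS.

(* beta_(i,j)(R/I) = dim_k Tor_i^R(R/I, k)_j, computed from a chosen graded free
   resolution of R/I.  The value is determined only once a resolution is known
   to exist and the dimension is known not to depend on it. *)
Definition betti (k : fieldType) (m : nat) (I : {mpoly k[m]} -> Prop)
  (i j : nat) : nat :=
  epsilon (inhabits 0%N)
    (fun b => exists F : graded_free_resolution I, homology_dim F i j = b).

(* Binomial coefficient of integers, 0 unless 0 <= b <= a. *)
Definition binz (a b : int) : nat :=
  if (0 <= b <= a)%R then 'C(`|a|%N, `|b|%N) else 0%N.

(* Main.v *)
(** Since [d = 2 alpha], the edges are [A_i U A_(i+1)] for disjoint blocks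
    [A_0, ..., A_n] of size [alpha], so with [y_i = x^(A_i)] the edge ideal is
    [I_n = (y_i y_(i+1) : i < n)], a path ideal in disjoint monomials.  As
    [I_(n-1) : y_(n-1) y_n = I_(n-1) : y_(n-1) = I_(n-3) + (y_(n-2))], the
    resolution of [R/I_n] is the cone of a map onto the resolution of
    [R/I_(n-1)] from that of [R/(I_(n-3) + (y_(n-2)))], which is itself a cone
    of multiplication by [y_(n-2)].  The comparison map can be taken to be
    [y_n] times a lift of [y_(n-1)], so the cone is minimal and its bases give
    the recursion satisfied by the binomial formula.  Betti numbers do not
    depend on the resolution because two resolutions are homotopy equivalent. *)

Require Import Defs.
From mathcomp Require Import all_boot all_order all_algebra.
From mathcomp Require Import mpoly.
From mathcomp Require Import zify ring.
From Stdlib Require Import ClassicalEpsilon FunctionalExtensionality.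
From Stdlib Require Import PropExtensionality.

Set Implicit Arguments.
Unset Strict Implicit.
Unset Printing Implicit Defensive.

Import GRing.Theory.
Local Open Scope ring_scope.

(** * Homogeneous parts of polynomials and of matrices *)

(* The homogeneous part of degree [b - a]; it is zero when [b < a]. *)
Definition hpart (k : fieldType) (m a b : nat) (p : {mpoly k[m]}) :
    {mpoly k[m]} :=
  \sum_(u <- msupp p | (mdeg u + a == b)%N) p@_u *: 'X_[u].

Lemma mcoeff_hpart (k : fieldType) (m a b : nat) (p : {mpoly k[m]}) u :
  (hpart a b p)@_u = if (mdeg u + a == b)%N then p@_u else 0.
Proof.
rewrite /hpart raddf_sum /=.
under eq_bigr do rewrite mcoeffZ mcoeffX.
have [up|uNp] := boolP (u \in msupp p).
  rewrite big_mkcond (bigD1_seq u) ?msupp_uniq //= big1 => [|v /negPf vu].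
    by rewrite eqxx mulr1 addr0.
  by rewrite vu mulr0 if_same.
rewrite (memN_msupp_eq0 uNp) if_same big_seq_cond big1 // => v /andP[vp _].
by case: eqP uNp => [<-|]; rewrite ?vp // mulr0.
Qed.

Lemma hpartD (k : fieldType) (m a b : nat) (p q : {mpoly k[m]}) :
  hpart a b (p + q) = hpart a b p + hpart a b q.
Proof.
apply/mpolyP => u; rewrite mcoeffD !mcoeff_hpart mcoeffD.
by case: ifP => // _; rewrite addr0.
Qed.

Lemma hpart0 (k : fieldType) (m a b : nat) : hpart a b (0 : {mpoly k[m]}) = 0.
Proof. by apply/mpolyP => u; rewrite mcoeff_hpart mcoeff0 if_same. Qed.

Lemma hpart_sum (k : fieldType) (m a b : nat) (I : Type) (r : seq I)
    (F : I -> {mpoly k[m]}) :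
  hpart a b (\sum_(i <- r) F i) = \sum_(i <- r) hpart a b (F i).
Proof. by apply: big_morph; [exact: hpartD | exact: hpart0]. Qed.

Lemma msupp_hpart (k : fieldType) (m a b : nat) (p : {mpoly k[m]}) u :
  u \in msupp (hpart a b p) -> (mdeg u + a)%N = b /\ u \in msupp p.
Proof.
by rewrite !mcoeff_msupp mcoeff_hpart; case: ifP => [/eqP|]; rewrite ?eqxx.
Qed.

Lemma hpart_id (k : fieldType) (m a b : nat) (p : {mpoly k[m]}) :
  (forall u, u \in msupp p -> (mdeg u + a)%N = b) -> hpart a b p = p.
Proof.
move=> hp; apply/mpolyP => u; rewrite mcoeff_hpart.
case: eqP => // /eqP ne.
have [/hp/eqP|/memN_msupp_eq0->//] := boolP (u \in msupp p).
by rewrite (negPf ne).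
Qed.

Lemma hpart_eq0 (k : fieldType) (m a b : nat) (p : {mpoly k[m]}) :
  (forall u, u \in msupp p -> (mdeg u + a)%N <> b) -> hpart a b p = 0.
Proof.
move=> hp; apply/mpolyP => u; rewrite mcoeff_hpart mcoeff0.
by case: eqP => // eq_b; apply: memN_msupp_eq0; apply/negP => /hp.
Qed.

(** Here [p] is homogeneous of degree [c - b]. Degrees of monomials add up, so [q - hpart a b q]
    contributes nothing in degree [c - a]. *)
Lemma hpartM (k : fieldType) (m a b c : nat) (p q : {mpoly k[m]}) :
  (forall u, u \in msupp p -> (mdeg u + b)%N = c) ->
  hpart a c (p * q) = p * hpart a b q.
Proof.
move=> hp; have {1}-> : q = hpart a b q + (q - hpart a b q).
  by rewrite addrC subrK.
rewrite mulrDr hpartD [X in _ + X]hpart_eq0 ?addr0; last first.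
  move=> u /msuppM_le/allpairsP[[v w] /= [/hp vp wq ->]] eqc.
  move: wq; rewrite mcoeff_msupp mcoeffB mcoeff_hpart.
  have -> : (mdeg w + a)%N = b by move: eqc; rewrite mdegD; lia.
  by rewrite eqxx subrr eqxx.
apply: hpart_id => u /msuppM_le/allpairsP[[v w] /= [/hp vp /msupp_hpart[wq _] ->]].
by rewrite mdegD; lia.
Qed.

(** A degree-preserving map of graded free modules acting on rows, with basis degrees [ga] and [gb];
    [diff_graded] is the same condition. *)
Definition mxgraded (k : fieldType) (m p q : nat) (ga : 'I_p -> nat)
    (gb : 'I_q -> nat) (A : 'M[{mpoly k[m]}]_(p, q)) : Prop :=
  forall i j u, u \in msupp (A i j) -> (mdeg u + gb j)%N = ga i.

Definition mxhpart (k : fieldType) (m p q : nat) (ga : 'I_p -> nat)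
    (gb : 'I_q -> nat) (A : 'M[{mpoly k[m]}]_(p, q)) :
    'M[{mpoly k[m]}]_(p, q) :=
  \matrix_(i, j) hpart (gb j) (ga i) (A i j).

Lemma mxhpart_graded (k : fieldType) (m p q : nat) (ga : 'I_p -> nat)
    (gb : 'I_q -> nat) (A : 'M[{mpoly k[m]}]_(p, q)) :
  mxgraded ga gb (mxhpart ga gb A).
Proof. by move=> i j u; rewrite mxE => /msupp_hpart[]. Qed.

Lemma mxhpart_id (k : fieldType) (m p q : nat) (ga : 'I_p -> nat)
    (gb : 'I_q -> nat) (A : 'M[{mpoly k[m]}]_(p, q)) :
  mxgraded ga gb A -> mxhpart ga gb A = A.
Proof. by move=> gA; apply/matrixP => i j; rewrite mxE hpart_id //; apply: gA. Qed.

(** Used to replace an arbitrary lift through a graded map by a graded one. *)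
Lemma mxhpart_mulmxl (k : fieldType) (m p q r : nat) (ga : 'I_p -> nat)
    (gb : 'I_q -> nat) (gc : 'I_r -> nat) A (D : 'M[{mpoly k[m]}]_(q, r)) :
  mxgraded gb gc D -> mxhpart ga gc (A *m D) = mxhpart ga gb A *m D.
Proof.
move=> gD; apply/matrixP => i j; rewrite !mxE hpart_sum; apply: eq_bigr => l _.
rewrite mxE [in LHS]mulrC [in RHS]mulrC.
apply/mpolyP => u; rewrite mcoeff_hpart.
(* Both sides are raised by [gb l] because [hpartM] works with natural numbers and [ga i] may be
   smaller than the degree of [D l j]. *)
have -> : (mdeg u + gc j == ga i)%N = (mdeg u + (gc j + gb l) == ga i + gb l)%N.
  by rewrite addnA eqn_add2r.
rewrite -mcoeff_hpart (@hpartM _ _ _ (ga i + gc j)%N) => [|v /gD]; last lia.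
congr (_ * _)@_u; apply/mpolyP => v; rewrite !mcoeff_hpart.
by congr (if _ then _ else _); apply/eqP/eqP; lia.
Qed.

Lemma mxgraded_mulmx (k : fieldType) (m p q r : nat) (ga : 'I_p -> nat)
    (gb : 'I_q -> nat) (gc : 'I_r -> nat) (A : 'M[{mpoly k[m]}]_(p, q))
    (B : 'M[{mpoly k[m]}]_(q, r)) :
  mxgraded ga gb A -> mxgraded gb gc B -> mxgraded ga gc (A *m B).
Proof.
move=> gA gB; rewrite -(mxhpart_id gA) -(@mxhpart_mulmxl _ _ _ _ _ ga gb gc) //.
exact: mxhpart_graded.
Qed.

Lemma mxgraded_shift (k : fieldType) (m p q e : nat) (ga : 'I_p -> nat)
    (gb : 'I_q -> nat) (A : 'M[{mpoly k[m]}]_(p, q)) :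
  mxgraded ga gb A ->
  mxgraded (fun i => ga i + e)%N (fun i => gb i + e)%N A.
Proof. by move=> gA i j u /gA <-; rewrite addnA. Qed.

(** * Homogeneous ideals, comparison maps and homotopies *)

Definition homogeneous_ideal (k : fieldType) (m : nat)
    (I : {mpoly k[m]} -> Prop) : Prop :=
  [/\ I 0, forall p q, I p -> I q -> I (p + q),
      forall c p, I p -> I (c * p) & forall d p, I p -> I (hpart 0 d p)].

Lemma ideal_sub (k : fieldType) (m : nat) (I : {mpoly k[m]} -> Prop) p q :
  homogeneous_ideal I -> I p -> I q -> I (p - q).
Proof. by case=> _ ID IM _ Ip Iq; apply: ID => //; rewrite -mulN1r; apply: IM. Qed.

Lemma ideal_sum (k : fieldType) (m : nat) (I : {mpoly k[m]} -> Prop)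
    (T : Type) (r : seq T) (P : pred T) F :
  homogeneous_ideal I -> (forall i, P i -> I (F i)) -> I (\sum_(i <- r | P i) F i).
Proof. by case=> I0 ID _ _ IF; apply: big_ind. Qed.

Lemma row_liftP (R : nzRingType) (p q r : nat) (M : 'M[R]_(p, r))
    (N : 'M[R]_(q, r)) :
  (forall i, exists w, row i M = w *m N) -> exists W, M = W *m N.
Proof.
move=> /fin_all_exists[w Mw]; exists (\matrix_i w i).
by apply/row_matrixP => i; rewrite Mw row_mul rowK.
Qed.

Lemma diff_diff (k : fieldType) (m : nat) (I : {mpoly k[m]} -> Prop)
    (F : graded_free_resolution I) i : diff F i.+1 *m diff F i = 0.
Proof.
apply/row_matrixP => a; rewrite row_mul row0; apply/exact_at_S.
by exists (delta_mx ord0 a); rewrite rowE.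
Qed.

Lemma lift_boundary (k : fieldType) (m : nat) (I : {mpoly k[m]} -> Prop)
    (F : graded_free_resolution I) i p (M : 'M_(p, rk F i.+1)) :
  M *m diff F i = 0 -> exists W, M = W *m diff F i.+1.
Proof.
by move=> Md; apply: row_liftP => a; apply/exact_at_S; rewrite -row_mul Md row0.
Qed.

Lemma lift_boundary0 (k : fieldType) (m : nat) (I : {mpoly k[m]} -> Prop)
    (F : graded_free_resolution I) p (M : 'M_(p, rk F 0)) :
  (forall a, I ((M *m aug F) a ord0)) -> exists W, M = W *m diff F 0.
Proof.
move=> Md; apply: row_liftP => a; apply/exact_at_0.
by rewrite -row_mul mxE.
Qed.

Lemma boundary_aug (k : fieldType) (m : nat) (I : {mpoly k[m]} -> Prop)
    (F : graded_free_resolution I) p (W : 'M_(p, rk F 1)) a :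
  I ((W *m diff F 0 *m aug F) a ord0).
Proof.
have : I ((row a W *m diff F 0 *m aug F) ord0 ord0).
  by apply/exact_at_0; exists (row a W).
by rewrite -!row_mul mxE.
Qed.

Lemma mul_aug_ideal (k : fieldType) (m : nat) (I : {mpoly k[m]} -> Prop)
    p q (M : 'M[{mpoly k[m]}]_(p, q)) (v : 'cV_q) a :
  homogeneous_ideal I -> (forall b, I (v b ord0)) -> I ((M *m v) a ord0).
Proof.
move=> hI Iv; rewrite mxE; apply: ideal_sum => // b _.
by case: hI => _ _ IM _; apply: IM.
Qed.

Lemma lift_graded (k : fieldType) (m p q r : nat) (ga : 'I_p -> nat)
    (gb : 'I_q -> nat) (gc : 'I_r -> nat) (M : 'M[{mpoly k[m]}]_(p, r)) W
    (N : 'M[{mpoly k[m]}]_(q, r)) :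
  mxgraded ga gc M -> mxgraded gb gc N -> M = W *m N ->
  M = mxhpart ga gb W *m N.
Proof. by move=> gM gN MWN; rewrite -(mxhpart_mulmxl ga W gN) -MWN mxhpart_id. Qed.

Lemma diff_mxgraded (k : fieldType) (m : nat) (I : {mpoly k[m]} -> Prop)
    (F : graded_free_resolution I) i :
  mxgraded (@gdeg _ _ _ F i.+1) (@gdeg _ _ _ F i) (diff F i).
Proof. by move=> a b u; apply: diff_graded. Qed.

(** Builds chain maps and homotopies, where each new term must be compatible with the one before. *)
Lemma dependent_choice_nat (T : nat -> Type)
    (P : forall i, T i -> T i.+1 -> Prop) (x0 : T 0%N) :
  (forall i x, exists y, P i x y) ->
  exists f : forall i, T i, f 0%N = x0 /\ forall i, P i (f i) (f i.+1).
Proof.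
move=> ex; pose next i x := sval (constructive_indefinite_description _ (ex i x)).
exists (nat_rect T x0 next); split=> // i /=.
exact: (svalP (constructive_indefinite_description _ (ex i _))).
Qed.

(* The property of [phi i] carried along the recursion, [diff F i *m phi i] lifts
   through [diff G i], has the same shape for [i = 0] and for [i > 0].  Lifts
   exist by exactness, and graded ones are obtained by taking homogeneous parts. *)
Lemma lift_resolution (k : fieldType) (m : nat)
    (I J : {mpoly k[m]} -> Prop) (F : graded_free_resolution J)
    (G : graded_free_resolution I) (q : {mpoly k[m]}) (e : nat) :
  homogeneous_ideal I -> (forall u, u \in msupp q -> mdeg u = e) ->
  (forall p, J p -> I (q * p)) ->
  exists phi : forall i, 'M[{mpoly k[m]}]_(rk F i, rk G i),
    [/\ forall i, mxgraded (fun a : 'I_(rk F i) => gdeg a + e)%N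
                    (@gdeg _ _ _ G i) (phi i),
        forall a, I (q * aug F a ord0 - (phi 0%N *m aug G) a ord0)
      & forall i, diff F i *m phi i = phi i.+1 *m diff G i].
Proof.
move=> hI hq JI.
pose gF i (a : 'I_(rk F i)) := (gdeg a + e)%N.
pose gG i := @gdeg _ _ _ G i.
have gdF i : mxgraded (@gF i.+1) (@gF i) (diff F i).
  by apply: mxgraded_shift; apply: diff_mxgraded.
have [W hW] : exists W, forall a, I (q * aug F a ord0 - (W *m aug G) a ord0).
  have /fin_all_exists[w hw] a := aug_surjective G (q * aug F a ord0).
  exists (\matrix_a w a) => a; have := hw a.
  by rewrite -(rowK w a) -row_mul [X in _ - X]mxE.
pose phi0 := mxhpart (@gF 0%N) (@gG 0%N) W.
have gphi0 : mxgraded (@gF 0%N) (@gG 0%N) phi0 by apply: mxhpart_graded.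
have aphi0 a : I (q * aug F a ord0 - (phi0 *m aug G) a ord0).
  have gaug : mxgraded (@gG 0%N) (fun _ : 'I_1 => 0%N) (aug G).
    by move=> i j u; rewrite ord1 addn0; apply: aug_graded.
  have := mxhpart_mulmxl (@gF 0%N) W gaug => /matrixP/(_ a ord0).
  rewrite mxE => <-; case: (hI) => _ _ _ /(_ (gF 0%N a) _ (hW a)).
  rewrite -mulN1r hpartD.
  rewrite [X in X + _]hpart_id => [|u]; last first.
    move=> /msuppM_le/allpairsP[[v w] /= [/hq qv /aug_graded Fw ->]].
    by rewrite mdegD addn0 qv Fw addnC.
  rewrite (@hpartM _ _ _ (gF 0%N a)) ?mulN1r // => u.
  rewrite (perm_mem (msuppN _)) msupp1 inE => /eqP->.
  by rewrite mdeg0.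
pose T i := {phi : 'M[{mpoly k[m]}]_(rk F i, rk G i) |
  mxgraded (@gF i) (@gG i) phi /\ exists W, diff F i *m phi = W *m diff G i}.
pose P i (x : T i) (y : T i.+1) := diff F i *m sval x = sval y *m diff G i.
have i0 : exists W, diff F 0 *m phi0 = W *m diff G 0.
  apply: lift_boundary0 => a.
  (* The entries of [diff F 0 *m aug F] lie in [J], so [q] sends them into [I]; the second term
     combines the differences in [aphi0]. *)
  have -> : (diff F 0 *m phi0 *m aug G) a ord0 =
      q * (diff F 0 *m aug F) a ord0 -
      (diff F 0 *m (q *: aug F - phi0 *m aug G)) a ord0.
    by rewrite mulmxBr -scalemxAr mulmxA !mxE; ring.
  apply: ideal_sub => //.
    by apply: JI; have := boundary_aug (1%:M) a; rewrite mul1mx.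
  by apply: mul_aug_ideal => // b; have := aphi0 b; rewrite !mxE.
have step i (x : T i) : exists y, P i x y.
  case: x => phi [gphi [W' hW']].
  have hg := lift_graded (mxgraded_mulmx (gdF i) gphi) (@diff_mxgraded _ _ _ G i)
    hW'.
  set U := mxhpart _ _ _ in hg.
  have ext : exists W, diff F i.+1 *m U = W *m diff G i.+1.
    by apply: lift_boundary; rewrite -mulmxA -hg mulmxA diff_diff mul0mx.
  by exists (exist _ U (conj (@mxhpart_graded _ _ _ _ _ _ W') ext)).
have [f [f0 fP]] :=
  dependent_choice_nat (exist _ phi0 (conj gphi0 i0) : T 0%N) step.
exists (fun i => sval (f i)); split=> [i|a|i]; first by case: (svalP (f i)).
  by rewrite f0.
exact: fP.
Qed.

(** [chi] lifts the zero map of [R/I], so exactness of [F] yields the terms of a homotopy one after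
    another. *)
Lemma null_homotopy (k : fieldType) (m : nat)
    (I : {mpoly k[m]} -> Prop) (F : graded_free_resolution I)
    (chi : forall i, 'M[{mpoly k[m]}]_(rk F i)) :
  (forall a, I ((chi 0%N *m aug F) a ord0)) ->
  (forall i, diff F i *m chi i = chi i.+1 *m diff F i) ->
  exists h : forall i, 'M[{mpoly k[m]}]_(rk F i, rk F i.+1),
    chi 0%N = h 0%N *m diff F 0%N /\
    forall i, chi i.+1 = diff F i *m h i + h i.+1 *m diff F i.+1.
Proof.
move=> /lift_boundary0[h0 ch0] chd.
(* Since [chi] commutes with the differentials, this invariant says that [diff F i] kills
   [chi i.+1 - diff F i *m h], which therefore lifts. *)
pose T i := {h : 'M[{mpoly k[m]}]_(rk F i, rk F i.+1) |
  diff F i *m chi i = diff F i *m h *m diff F i}.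
pose P i (x : T i) (y : T i.+1) :=
  chi i.+1 = diff F i *m sval x + sval y *m diff F i.+1.
have step i (x : T i) : exists y, P i x y.
  case: x => h hh.
  have [h' hh'] : exists h', chi i.+1 - diff F i *m h = h' *m diff F i.+1.
    by apply: lift_boundary; rewrite mulmxBl -hh chd subrr.
  have eqn : chi i.+1 = diff F i *m h + h' *m diff F i.+1.
    by rewrite -hh' addrC subrK.
  have ext : diff F i.+1 *m chi i.+1 = diff F i.+1 *m h' *m diff F i.+1.
    by rewrite eqn mulmxDr mulmxA diff_diff mul0mx add0r mulmxA.
  by exists (exist _ h' ext).
have e0 : diff F 0 *m chi 0%N = diff F 0 *m h0 *m diff F 0 by rewrite ch0 mulmxA.
have [f [f0 fP]] := dependent_choice_nat (exist _ h0 e0 : T 0%N) step.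
by exists (fun i => sval (f i)); split=> //; rewrite f0.
Qed.

(** * Independence of the homology dimensions from the resolution *)

(** The complement [C] of the boundaries is embedded by [f] and its image meets [B'] only in 0, so
    the ranks of this image and of [Z' :&: B'] add up to at most that of [Z']. *)
Lemma rank_homology_le (k : fieldType) (p q b b' : nat) (Z : 'M[k]_p)
    (B : 'M_(b, p)) (Z' : 'M_q) (B' : 'M_(b', q)) (f : 'M_(p, q)) :
  (Z *m f <= Z')%MS ->
  (forall u : 'rV_p, u <= Z -> u *m f <= B' -> u <= B)%MS ->
  (\rank (Z :\: B) <= \rank (Z' :\: B'))%N.
Proof.
move=> ZfZ' fB; set C := (Z :\: B)%MS.
have CZ : (C <= Z)%MS by apply: diffmxSl.
have C0 (u : 'rV_p) : (u <= C)%MS -> (u *m f <= B')%MS -> u = 0.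
  move=> uC ufB; apply/eqP; rewrite -submx0 -(capmx_diff Z B) sub_capmx.
  by rewrite uC fB // (submx_trans uC).
have <- : \rank (C *m f) = \rank C.
  apply/mxrank_injP/rowV0P => v; rewrite sub_capmx => /andP[vC /sub_kermxP vf].
  by apply: C0; rewrite // vf sub0mx.
have CfB : (C *m f :&: (Z' :&: B') = 0)%MS.
  apply/eqP/rowV0P => v; rewrite !sub_capmx => /and3P[/submxP[w ->] _].
  by rewrite mulmxA => /C0-> //; rewrite ?mul0mx ?submxMl.
rewrite -(leq_add2l (\rank (Z' :&: B')%MS)) mxrank_cap_compl addnC.
rewrite -mxrank_disjoint_sum // mxrankS // addsmx_sub capmxSl andbT.
exact: submx_trans (submxMr f CZ) ZfZ'.
Qed.

(** The matrix of [component], for a grading that need not come from a resolution. *)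
Definition degree_proj (k : fieldType) (p : nat) (g : 'I_p -> nat) (j : nat) :
    'M[k]_p := diag_mx (\row_a (g a == j)%:R).

Lemma mxrank_degree_proj (k : fieldType) (p : nat) (g : 'I_p -> nat) (j : nat) :
  \rank (degree_proj k g j) = (\sum_a (g a == j))%N.
Proof.
have -> : \rank (degree_proj k g j) =
    \rank (\sum_(a | g a == j) <<delta_mx (ord0 : 'I_1) a : 'rV[k]_p>>)%MS.
  apply/eqmx_rank/andP; split.
    apply/row_subP => a; rewrite row_diag_mx mxE.
    case: eqP => [/eqP ga|_]; last by rewrite scale0r sub0mx.
    by rewrite scale1r (sumsmx_sup a) // genmxE.
  apply/sumsmx_subP => a ga; rewrite genmxE.
  have -> : delta_mx ord0 a = row a (degree_proj k g j).
    by rewrite row_diag_mx mxE ga scale1r.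
  exact: row_sub.
have /mxdirectP -> :=
  @mxdirect_delta k _ (fun a => g a == j) p id (in2W (fun _ _ => id)).
rewrite /= [RHS]big_mkcond /= [LHS]big_mkcond; apply: eq_bigr => a _.
by case: eqP => // _; rewrite mxrank_gen mxrank_delta.
Qed.

(** An entry with non-zero constant term joins basis elements of equal degree. *)
Lemma degree_proj_map (k : fieldType) (m p q : nat) (ga : 'I_p -> nat)
    (gb : 'I_q -> nat) (A : 'M[{mpoly k[m]}]_(p, q)) j :
  mxgraded ga gb A ->
  degree_proj k ga j *m map_mx (mcoeff 0%MM) A =
  map_mx (mcoeff 0%MM) A *m degree_proj k gb j.
Proof.
move=> gA; rewrite mul_diag_mx mul_mx_diag; apply/matrixP => a b.
rewrite !mxE mulrC; have [Aab|/memN_msupp_eq0->] := boolP (0%MM \in msupp (A a b)).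
  by rewrite -(gA _ _ _ Aab) mdeg0.
by rewrite !mul0r.
Qed.

Lemma sub_degree_proj (k : fieldType) (p : nat) (g : 'I_p -> nat) j (u : 'rV[k]_p) :
  (u <= degree_proj k g j)%MS = (u *m degree_proj k g j == u).
Proof.
apply/submxP/eqP => [[w ->]|<-]; last by exists u.
rewrite -mulmxA; congr (_ *m _); rewrite mul_diag_mx; apply/matrixP => a b.
by rewrite !mxE; case: eqP => _; rewrite ?mul0r ?mul1r ?mul0rn.
Qed.

Lemma sub_cyclesS (k : fieldType) (m : nat) (I : {mpoly k[m]} -> Prop)
    (F : graded_free_resolution I) i j (u : 'rV_(rk F i.+1)) :
  (u <= cycles F i.+1 j)%MS =
  (u *m degree_proj k (@gdeg _ _ _ F i.+1) j == u) && (u *m diff_k F i == 0).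
Proof. by rewrite sub_capmx sub_degree_proj sub_kermx. Qed.

Lemma sub_cycles (k : fieldType) (m : nat) (I : {mpoly k[m]} -> Prop)
    (F : graded_free_resolution I) i j (u : 'rV_(rk F i)) :
  (u <= cycles F i j)%MS -> u *m degree_proj k (@gdeg _ _ _ F i) j = u.
Proof.
case: i u => [|i] u; last by rewrite sub_cyclesS => /andP[/eqP].
by move=> /= uP; apply/eqP; rewrite -sub_degree_proj.
Qed.

Lemma diff_k_degree_proj (k : fieldType) (m : nat) (I : {mpoly k[m]} -> Prop)
    (F : graded_free_resolution I) i j :
  degree_proj k (@gdeg _ _ _ F i.+1) j *m diff_k F i =
  diff_k F i *m degree_proj k (@gdeg _ _ _ F i) j.
Proof. exact: degree_proj_map (@diff_mxgraded _ _ _ F i). Qed.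

(* If [psi \o phi] is homotopic to the identity of [F] and [phi] is graded, then
   [phi] is injective on the homology in each degree; neither [psi] nor the
   homotopy has to be graded. *)
Lemma homology_dim_le (k : fieldType) (m : nat) (I : {mpoly k[m]} -> Prop)
    (F G : graded_free_resolution I) i j :
  homogeneous_ideal I -> (homology_dim F i j <= homology_dim G i j)%N.
Proof.
move=> hI.
have h1 u : u \in msupp (1 : {mpoly k[m]}) -> mdeg u = 0%N.
  by rewrite msupp1 inE => /eqP->; rewrite mdeg0.
have II p : I p -> I (1 * p) by rewrite mul1r.
have [phi [gphi aphi dphi]] := lift_resolution F G hI h1 II.
have [psi [_ apsi dpsi]] := lift_resolution G F hI h1 II.
(* Both [phi] and [psi] lift the identity of [R/I], so [chi] lifts zero and is null-homotopic. *)
pose chi l := phi l *m psi l - 1%:M.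
have achi a : I ((chi 0%N *m aug F) a ord0).
  have -> : (chi 0%N *m aug F) a ord0 =
      - (phi 0%N *m (1 *: aug G - psi 0%N *m aug F)) a ord0
      - (1 * aug F a ord0 - (phi 0%N *m aug G) a ord0).
    by rewrite mulmxBl mul1mx mulmxBr -scalemxAr mulmxA !mxE; ring.
  apply: ideal_sub => //; rewrite -[- _]sub0r; apply: ideal_sub => //.
    by case: hI.
  by apply: mul_aug_ideal => // b; have := apsi b; rewrite !mxE.
have dchi l : diff F l *m chi l = chi l.+1 *m diff F l.
  by rewrite mulmxBr mulmxBl mulmxA dphi -!mulmxA dpsi mulmx1 mul1mx.
have [h [h0 hS]] := null_homotopy achi dchi.
pose red p q (A : 'M[{mpoly k[m]}]_(p, q)) := map_mx (mcoeff 0%MM) A.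
have redM p q r (A : 'M_(p, q)) (B : 'M_(q, r)) :
    red _ _ (A *m B) = red _ _ A *m red _ _ B by exact: map_mxM.
have gphi0 l : mxgraded (@gdeg _ _ _ F l) (@gdeg _ _ _ G l) (phi l).
  by move=> a b u /gphi; rewrite addn0.
have cphi (v : 'rV_(rk F i)) : (v <= cycles F i j)%MS ->
    (v *m red _ _ (phi i) <= cycles G i j)%MS.
  move=> vZ; have vP := sub_cycles vZ.
  have : v *m red _ _ (phi i) *m degree_proj k (@gdeg _ _ _ G i) j =
      v *m red _ _ (phi i).
    by rewrite -mulmxA -(degree_proj_map j (gphi0 i)) mulmxA vP.
  case: i v vZ {vP} => [|i] v vZ vfP; first by rewrite /= sub_degree_proj vfP.
  move: vZ; rewrite !sub_cyclesS vfP eqxx => /andP[_ /eqP vd] /=.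
  by rewrite -mulmxA -redM -dphi redM mulmxA vd mul0mx.
apply: (@rank_homology_le _ _ _ _ _ _ _ _ _ (red _ _ (phi i)))
  => [|u uZ /submxP[w ufB]].
  by apply/row_subP => a; rewrite row_mul cphi ?row_sub.
(* A preimage of any degree is enough: projecting it to degree [j] does not change its image, as [u]
   is already in degree [j]. *)
suff [x ux] : exists x, u = x *m diff_k F i.
  have := sub_cycles uZ; rewrite ux -mulmxA -diff_k_degree_proj => <-.
  exact: submxMl.
have uchi : u = u *m red _ _ (phi i) *m red _ _ (psi i) - u *m red _ _ (chi i).
  by rewrite /red map_mxB map_mx1 map_mxM mulmxBr mulmx1 mulmxA opprB addrC subrK.
(* On a cycle, only the term of the homotopy that ends in [diff F i] survives. *)
have [y uy] : exists y, u *m red _ _ (chi i) = y *m diff_k F i.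
  case: i u uZ {cphi w ufB uchi} => [|i] u uZ.
    by rewrite h0 redM mulmxA; eexists.
  move: uZ; rewrite sub_cyclesS => /andP[_ /eqP ud].
  rewrite hS /red map_mxD !map_mxM mulmxDr !mulmxA.
  by rewrite ud mul0mx add0r; eexists.
exists (w *m degree_proj k (@gdeg _ _ _ G i.+1) j *m red _ _ (psi i.+1) - y).
rewrite uchi uy ufB mulmxBl; congr (_ - _).
rewrite -!mulmxA; congr (_ *m (_ *m _)).
by rewrite -[LHS]redM dpsi redM.
Qed.

Lemma homology_dim_eq (k : fieldType) (m : nat) (I : {mpoly k[m]} -> Prop)
    (F G : graded_free_resolution I) i j :
  homogeneous_ideal I -> homology_dim F i j = homology_dim G i j.
Proof. by move=> hI; apply/eqP; rewrite eqn_leq !homology_dim_le. Qed.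

(** [F] shows that the choice made by [epsilon] is realised by some resolution, and all resolutions
    give the same dimension. *)
Lemma betti_homology_dim (k : fieldType) (m : nat) (I : {mpoly k[m]} -> Prop)
    (F : graded_free_resolution I) i j :
  homogeneous_ideal I -> betti I i j = homology_dim F i j.
Proof.
move=> hI; rewrite /betti.
have [|G <-] := epsilon_spec (inhabits 0%N)
  (fun b => exists F : graded_free_resolution I, homology_dim F i j = b).
  by exists (homology_dim F i j), F.
exact: homology_dim_eq.
Qed.

Definition minimal_resolution (k : fieldType) (m : nat)
    (I : {mpoly k[m]} -> Prop) (F : graded_free_resolution I) : Prop :=
  forall i a b, (diff F i a b)@_0%MM = 0.

Lemma homology_dim_minimal (k : fieldType) (m : nat) (I : {mpoly k[m]} -> Prop)
    (F : graded_free_resolution I) i j :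
  minimal_resolution F ->
  homology_dim F i j = (\sum_(a < rk F i) (gdeg a == j))%N.
Proof.
move=> Fmin; have d0 l : diff_k F l = 0.
  by apply/matrixP => a b; rewrite !mxE Fmin.
rewrite /homology_dim; have := mxrank_cap_compl (cycles F i j) (boundaries F i j).
rewrite {1}/boundaries d0 mulmx0 capmx0 mxrank0 add0n => ->.
rewrite -(mxrank_degree_proj k); case: i => [//|i] /=.
apply/eqmx_rank; rewrite capmxSl sub_capmx submx_refl.
by apply/sub_kermxP; rewrite d0 mulmx0.
Qed.

(** * Mapping cones of graded resolutions *)

Definition cone_rk (r s : nat -> nat) (i : nat) : nat :=
  if i is i'.+1 then (r i + s i')%N else r 0%N.

Definition cone_gdeg (r s : nat -> nat) (g : forall i, 'I_(r i) -> nat)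
    (h : forall i, 'I_(s i) -> nat) (e i : nat) : 'I_(cone_rk r s i) -> nat :=
  match i return 'I_(cone_rk r s i) -> nat with
  | 0 => g 0%N
  | i'.+1 => fun a => match split a with
                      | inl b => g i'.+1 b
                      | inr c => (h i' c + e)%N
                      end
  end.

(** The sign on [d'] makes the lower left block of a composite equal to [psi d - d' psi], which
    vanishes for a chain map. *)
Definition cone_diff (R : nzRingType) (r s : nat -> nat)
    (d : forall i, 'M[R]_(r i.+1, r i)) (d' : forall i, 'M[R]_(s i.+1, s i))
    (psi : forall i, 'M[R]_(s i, r i)) (i : nat) :
    'M[R]_(cone_rk r s i.+1, cone_rk r s i) :=
  match i return 'M[R]_(cone_rk r s i.+1, cone_rk r s i) with
  | 0 => col_mx (d 0%N) (psi 0%N)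
  | i'.+1 => block_mx (d i'.+1) 0 (psi i'.+1) (- d' i')
  end.

Lemma cone_diff_graded (k : fieldType) (m e : nat) (r s : nat -> nat)
    (g : forall i, 'I_(r i) -> nat) (h : forall i, 'I_(s i) -> nat)
    (d : forall i, 'M[{mpoly k[m]}]_(r i.+1, r i))
    (d' : forall i, 'M[{mpoly k[m]}]_(s i.+1, s i))
    (psi : forall i, 'M[{mpoly k[m]}]_(s i, r i)) i :
  (forall i, mxgraded (@g i.+1) (@g i) (d i)) ->
  (forall i, mxgraded (@h i.+1) (@h i) (d' i)) ->
  (forall i, mxgraded (fun a => @h i a + e)%N (@g i) (psi i)) ->
  mxgraded (@cone_gdeg r s g h e i.+1) (@cone_gdeg r s g h e i)
    (cone_diff d d' psi i).
Proof.
move=> gd gd' gpsi; case: i => [|i] /= a b u.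
  by rewrite mxE; case: (split a) => c; [apply: gd | apply: gpsi].
rewrite /block_mx mxE; case: (split a) => c; rewrite mxE; case: (split b) => c'.
- exact: gd.
- by rewrite mxE msupp0.
- exact: gpsi.
- by rewrite mxE (perm_mem (msuppN _)) => /gd' <-; rewrite addnA.
Qed.

Definition ideal_add (k : fieldType) (m : nat) (I : {mpoly k[m]} -> Prop)
    (q p : {mpoly k[m]}) : Prop := exists a c : {mpoly k[m]}, I a /\ p = a + c * q.

(** [psi] lifts multiplication by [q] from [R/J] to [R/I], injective by the last hypothesis, so its
    cone has no homology in positive degrees. Injectivity enters at the bottom of [G], exactness of
    [G] above it. *)
Lemma cone_exact_at_S (k : fieldType) (m : nat) (I J : {mpoly k[m]} -> Prop)
    (F : graded_free_resolution I) (G : graded_free_resolution J) (q : {mpoly k[m]})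
    (psi : forall i, 'M[{mpoly k[m]}]_(rk G i, rk F i)) i
    (v : 'rV_(cone_rk (rk F) (rk G) i.+1)) :
  homogeneous_ideal I ->
  (forall a, I (q * aug G a ord0 - (psi 0%N *m aug F) a ord0)) ->
  (forall i, diff G i *m psi i = psi i.+1 *m diff F i) ->
  (forall p, I (q * p) -> J p) ->
  v *m cone_diff (diff F) (diff G) psi i = 0 <->
  exists w, v = w *m cone_diff (diff F) (diff G) psi i.+1.
Proof.
move=> hI apsi dpsi IJ; split; last first.
  case=> w ->; rewrite -mulmxA; suff -> : cone_diff (diff F) (diff G) psi i.+1 *m
      cone_diff (diff F) (diff G) psi i = 0 by rewrite mulmx0.
  case: i v w => [|i] _ _ /=.
    by rewrite mul_block_col diff_diff mul0mx addr0 mulNmx -dpsi subrr col_mx0.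
  rewrite mulmx_block !diff_diff !(mul0mx, mulmx0, addr0, add0r).
  by rewrite mulNmx -dpsi subrr mulNmx mulmxN opprK diff_diff block_mx0.
(* Once the second component of a cycle is a boundary, subtracting [w2 *m psi i.+1] from the first
   leaves a cycle of [F], hence a boundary. *)
have extend p (v1 : 'M_(p, rk F i.+1)) v2 w2 : v1 *m diff F i + v2 *m psi i = 0 ->
    v2 = - (w2 *m diff G i) ->
    exists w1, row_mx v1 v2 = row_mx w1 w2 *m
      block_mx (diff F i.+1) 0 (psi i.+1) (- diff G i).
  move=> v12 v2E.
  have [w1 w1E] : exists w1, v1 - w2 *m psi i.+1 = w1 *m diff F i.+1.
    apply: lift_boundary; rewrite mulmxBl -mulmxA -dpsi mulmxA.
    by rewrite -v12 v2E mulNmx.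
  exists w1; rewrite mul_row_block mulmx0 add0r mulmxN -v2E -w1E.
  by rewrite subrK.
move=> v0; suff [w2 w2E] : exists w2, rsubmx v = - (w2 *m diff G i).
  have [|w1 w1E] := extend _ (lsubmx v) (rsubmx v) w2 _ w2E.
    case: i v v0 {extend w2 w2E} => [|i] v /=; rewrite -{1}[v]hsubmxK.
      by rewrite mul_row_col.
    by rewrite mul_row_block -row_mx0 => /eq_row_mx[].
  by exists (row_mx w1 w2); rewrite -w1E hsubmxK.
case: i v v0 {extend} => [|i] v /=; rewrite -{1}[v]hsubmxK.
  rewrite mul_row_col => v0.
  (* As [v] is a cycle, [q] times the augmentation of [- rsubmx v] lies in [I], so that augmentation
     lies in [J]. *)
  have [|w wE] := @lift_boundary0 _ _ _ G _ (- rsubmx v).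
    move=> a; apply: IJ.
    have -> : q * (- rsubmx v *m aug G) a ord0 =
        (lsubmx v *m diff F 0 *m aug F) a ord0
        - (rsubmx v *m (q *: aug G - psi 0%N *m aug F)) a ord0.
      rewrite mulmxBr -scalemxAr mulmxA mulNmx.
      move/eqP: v0; rewrite addr_eq0 => /eqP ->.
      by rewrite mulNmx !mxE; ring.
    apply: ideal_sub (boundary_aug _ _) _ => //.
    by apply: mul_aug_ideal => // b; have := apsi b; rewrite !mxE.
  by exists w; rewrite -wE opprK.
rewrite mul_row_block -row_mx0 => /eq_row_mx[_].
rewrite mulmx0 add0r mulmxN => /eqP; rewrite oppr_eq0 => /eqP /lift_boundary[w wE].
by exists (- w); rewrite mulNmx opprK.
Qed.

(** The new relations [psi 0%N] augment to multiples of [q] modulo [I]. Conversely, if [v] augments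
    to [a + c * q], lifting [c] to [u] over [G] leaves [v - u *m psi 0%N] with augmentation in
    [I]. *)
Lemma cone_exact_at_0 (k : fieldType) (m : nat) (I J : {mpoly k[m]} -> Prop)
    (F : graded_free_resolution I) (G : graded_free_resolution J) (q : {mpoly k[m]})
    (psi : forall i, 'M[{mpoly k[m]}]_(rk G i, rk F i)) (v : 'rV_(rk F 0)) :
  homogeneous_ideal I ->
  (forall a, I (q * aug G a ord0 - (psi 0%N *m aug F) a ord0)) ->
  (forall p, J p -> I (q * p)) ->
  ideal_add I q ((v *m aug F) ord0 ord0) <->
  exists w, v = w *m cone_diff (diff F) (diff G) psi 0.
Proof.
move=> hI apsi JI.
have lift (u : 'rV_(rk G 0)) :
    I (q * (u *m aug G) ord0 ord0 - (u *m psi 0%N *m aug F) ord0 ord0).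
  have -> : q * (u *m aug G) ord0 ord0 - (u *m psi 0%N *m aug F) ord0 ord0
     = (u *m (q *: aug G - psi 0%N *m aug F)) ord0 ord0.
    by rewrite mulmxBr -scalemxAr mulmxA !mxE.
  by apply: mul_aug_ideal => // b; have := apsi b; rewrite !mxE.
split=> [[a [c [Ia vE]]]|[w ->]] /=; last first.
  rewrite -{1}[w]hsubmxK mul_row_col mulmxDl.
  set x := lsubmx w; set y := rsubmx w.
  exists ((x *m diff F 0 *m aug F) ord0 ord0 -
     (q * (y *m aug G) ord0 ord0 - (y *m psi 0%N *m aug F) ord0 ord0)).
  exists ((y *m aug G) ord0 ord0); split.
    exact: ideal_sub (boundary_aug _ _) _.
  by rewrite [LHS]mxE; ring.
have [u hu] := aug_surjective G c.
have [|w1 w1E] := @lift_boundary0 _ _ _ F _ (v - u *m psi 0%N).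
  move=> b; rewrite ord1 mulmxBl.
  have -> : (v *m aug F - u *m psi 0%N *m aug F) ord0 ord0 =
     a + (q * (c - (u *m aug G) ord0 ord0) +
     (q * (u *m aug G) ord0 ord0 - (u *m psi 0%N *m aug F) ord0 ord0)).
    by rewrite mxE vE [in LHS]mxE; ring.
  by case: (hI) => _ addI _ _; apply: (addI) => //; apply: addI (JI _ hu) (lift u).
by exists (row_mx w1 u); rewrite mul_row_col -w1E subrK.
Qed.

(** A graded Betti number when [F] is minimal. *)
Definition basis_count (k : fieldType) (m : nat) (I : {mpoly k[m]} -> Prop)
    (F : graded_free_resolution I) (i t : nat) : nat :=
  (\sum_(a < rk F i) (gdeg a == t))%N.

(** Since [q1] carries [J] into [I], the comparison map can be [q2] times a lift of [q1]; as [q2]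
    has positive degree, its entries have no constant term and the cone is minimal. The counts are
    split at [e1 + e2] to avoid subtracting degrees. *)
Lemma cone_resolution (k : fieldType) (m e1 e2 : nat)
    (I J : {mpoly k[m]} -> Prop) (F : graded_free_resolution I)
    (G : graded_free_resolution J) (q1 q2 : {mpoly k[m]}) :
  homogeneous_ideal I -> (forall p, J p -> I (q1 * p)) ->
  (forall p, I (q1 * q2 * p) -> J p) ->
  (forall u, u \in msupp q1 -> mdeg u = e1) ->
  (forall u, u \in msupp q2 -> mdeg u = e2) -> (0 < e2)%N ->
  minimal_resolution F -> minimal_resolution G ->
  exists C : graded_free_resolution (ideal_add I (q1 * q2)),
    [/\ minimal_resolution C, basis_count C 0 =1 basis_count F 0
      & forall i t, basis_count C i.+1 (t + (e1 + e2)) =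
          (basis_count F i.+1 (t + (e1 + e2)) + basis_count G i t)%N /\
        ((t < e1 + e2)%N -> basis_count C i.+1 t = basis_count F i.+1 t)].
Proof.
move=> hI JI IJ dq1 dq2 e2_gt0 Fmin Gmin.
have [phi [gphi aphi dphi]] := lift_resolution G F hI dq1 JI.
pose psi i : 'M[{mpoly k[m]}]_(rk G i, rk F i) := q2 *: phi i.
have q2_0 : q2@_0%MM = 0.
  by apply: memN_msupp_eq0; apply/negP => /dq2; rewrite mdeg0; lia.
have gpsi i : mxgraded (fun a : 'I_(rk G i) => gdeg a + (e1 + e2))%N
    (@gdeg _ _ _ F i) (psi i).
  move=> a b u; rewrite mxE.
  move=> /msuppM_le/allpairsP[[v w] /= [/dq2 vq /gphi wphi ->]].
  by rewrite mdegD; lia.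
have JI' p : J p -> I (q1 * q2 * p).
  by move=> /JI; case: (hI) => _ _ mulI _ /(mulI q2); rewrite mulrA (mulrC q2).
have apsi a : I (q1 * q2 * aug G a ord0 - (psi 0%N *m aug F) a ord0).
  have -> : q1 * q2 * aug G a ord0 - (psi 0%N *m aug F) a ord0 =
      q2 * (q1 * aug G a ord0 - (phi 0%N *m aug F) a ord0).
    by rewrite -scalemxAl [in LHS]mxE; ring.
  by case: hI => _ _ mulI _; apply: mulI.
have dpsi i : diff G i *m psi i = psi i.+1 *m diff F i.
  by rewrite -scalemxAr dphi scalemxAl.
have surj (p : {mpoly k[m]}) : exists v : 'rV_(rk F 0),
    ideal_add I (q1 * q2) (p - (v *m aug F) ord0 ord0).
  by have [v hv] := aug_surjective F p; exists v, (p - (v *m aug F) ord0 ord0), 0;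
    rewrite mul0r addr0.
pose C := @GradedFreeResolution k m (ideal_add I (q1 * q2)) (cone_rk (rk F) (rk G))
  (cone_gdeg (@gdeg _ _ _ F) (@gdeg _ _ _ G) (e1 + e2))
  (cone_diff (diff F) (diff G) psi) (aug F)
  (fun i => cone_diff_graded (@diff_mxgraded _ _ _ F) (@diff_mxgraded _ _ _ G) gpsi)
  (@aug_graded _ _ _ F) surj
  (fun v => cone_exact_at_0 v hI apsi JI')
  (fun i v => cone_exact_at_S v hI apsi dpsi IJ).
have psi0 i a b : (psi i a b)@_0%MM = 0.
  by rewrite mxE rmorphM /= q2_0 mul0r.
have countS i t : basis_count C i.+1 t = (basis_count F i.+1 t +
    \sum_(a < rk G i) (gdeg a + (e1 + e2) == t))%N.
  rewrite /basis_count big_split_ord /=; congr (_ + _)%N; apply: eq_bigr => a _.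
    by rewrite (unsplitK (inl a)).
  by rewrite (unsplitK (inr a)).
exists C; split=> [i a b||i t] //; last first.
  rewrite !countS; split=> [|t_lt]; last first.
    by rewrite big1 ?addn0 // => a _; apply/eqP; rewrite eqb0; apply/eqP; lia.
  by congr (_ + _)%N; apply: eq_bigr => a _; rewrite eqn_add2r.
case: i a b => [|i] a b /=.
  by rewrite mxE; case: (split a) => c; rewrite ?Fmin ?psi0.
rewrite /block_mx mxE; case: (split a) => c; rewrite mxE; case: (split b) => c'.
- exact: Fmin.
- by rewrite mxE mcoeff0.
- exact: psi0.
- by rewrite mxE mcoeffN Gmin oppr0.
Qed.

(** * The zero ideal and monomial ideals *)

Lemma zero_ideal_resolution (k : fieldType) (m : nat) :
  exists C : graded_free_resolution (fun p : {mpoly k[m]} => p = 0),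
    minimal_resolution C /\
    forall i t, basis_count C i t = ((i == 0) && (t == 0))%N.
Proof.
pose rC i : nat := if i is 0 then 1%N else 0%N.
pose C0 : 'M[{mpoly k[m]}]_1 := 1%:M.
have vE (v : 'rV[{mpoly k[m]}]_1) : (v *m C0) ord0 ord0 = v ord0 ord0.
  by rewrite mulmx1.
have dgr i (a : 'I_(rC i.+1)) (b : 'I_(rC i)) (u : 'X_{1..m}) :
  u \in msupp ((0 : 'M[{mpoly k[m]}]_(rC i.+1, rC i)) a b) -> (mdeg u + 0)%N = 0%N.
  by case: a.
have agr (a : 'I_1) (u : 'X_{1..m}) : u \in msupp (C0 a ord0) -> mdeg u = 0%N.
  by rewrite ord1 mxE msupp1 inE => /eqP->; rewrite mdeg0.
have surj (p : {mpoly k[m]}) : exists v : 'rV_1, p - (v *m C0) ord0 ord0 = 0.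
  by exists p%:M; rewrite vE mxE subrr.
have ex0 (v : 'rV[{mpoly k[m]}]_1) : (v *m C0) ord0 ord0 = 0 <->
    exists w : 'rV_(rC 1%N), v = w *m (0 : 'M_(rC 1%N, rC 0%N)).
  rewrite vE; split=> [v0|[w ->]]; last by rewrite mulmx0 mxE.
  by exists 0; rewrite mulmx0; apply/matrixP => a b; rewrite !ord1 v0 mxE.
have exS i (v : 'rV[{mpoly k[m]}]_(rC i.+1)) : v *m (0 : 'M_(rC i.+1, rC i)) = 0 <->
    exists w : 'rV_(rC i.+2), v = w *m (0 : 'M_(rC i.+2, rC i.+1)).
  by split=> _; [exists 0; apply/matrixP => a [] | rewrite mulmx0].
exists (@GradedFreeResolution k m (fun p => p = 0) rC (fun _ _ => 0%N)
  (fun i => 0) C0 dgr agr surj ex0 exS); split=> [i []//|[|i] t].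
  by rewrite /basis_count big_ord_recl big_ord0 addn0 eq_sym.
by rewrite /basis_count big_ord0.
Qed.

(** The ideal generated by the monomials [gs], encoded by divisibility so that colon ideals become
    statements about exponents. *)
Definition mideal (k : fieldType) (m : nat) (gs : seq 'X_{1..m})
    (p : {mpoly k[m]}) : Prop :=
  forall u, u \in msupp p -> has (fun g => (g <= u)%MM) gs.

Lemma has_lem_trans (m : nat) (gs : seq 'X_{1..m}) (u v : 'X_{1..m}) :
  (u <= v)%MM -> has (fun g => (g <= u)%MM) gs -> has (fun g => (g <= v)%MM) gs.
Proof. by move=> uv; apply: sub_has => g /lepm_trans; apply. Qed.

Lemma mideal_homogeneous (k : fieldType) (m : nat) (gs : seq 'X_{1..m}) :
  homogeneous_ideal (@mideal k m gs).
Proof.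
split=> [u|p q Ip Iq u|c p Ip u|d p Ip u]; first by rewrite msupp0.
- by move/msuppD_le; rewrite mem_cat => /orP[/Ip|/Iq].
- move=> /msuppM_le/allpairsP[[v w] /= [_ /Ip wp ->]].
  exact: has_lem_trans (lem_addl _ _) wp.
- by case/msupp_hpart=> _ /Ip.
Qed.

Lemma mideal_monomial (k : fieldType) (m : nat) (gs : seq 'X_{1..m}) (c : k) u :
  has (fun g => (g <= u)%MM) gs -> mideal gs (c *: 'X_[u]).
Proof. by move=> hu v /msuppZ_le; rewrite msuppX inE => /eqP->. Qed.

(** An equality of predicates can rewrite the type of a resolution. *)
Lemma mideal0 (k : fieldType) (m : nat) :
  @mideal k m [::] = (fun p => p = 0).
Proof.
apply: functional_extensionality => p; apply: propositional_extensionality.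
split=> [Ip|-> u]; last by rewrite msupp0.
by apply/mpolyP => u; rewrite mcoeff0; apply: memN_msupp_eq0; apply/negP => /Ip.
Qed.

(** The terms of [p] divisible by [g] form the multiple of ['X_[g]]; each other term is divisible by
    a member of [gs]. *)
Lemma mideal_cons (k : fieldType) (m : nat) (g : 'X_{1..m}) gs :
  @mideal k m (g :: gs) = ideal_add (mideal gs) 'X_[g].
Proof.
apply: functional_extensionality => p; apply: propositional_extensionality.
split=> [Ip|[a [c [Ia ->]]] u].
  exists (\sum_(u <- msupp p | ~~ (g <= u)%MM) p@_u *: 'X_[u]).
  exists (\sum_(u <- msupp p | (g <= u)%MM) p@_u *: 'X_[u - g]); split.
    rewrite big_seq_cond; apply: ideal_sum; first exact: mideal_homogeneous.
    by move=> u /andP[/Ip /= /orP[->//|gsu] _]; apply: mideal_monomial.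
  rewrite {1}[p]mpolyE (bigID (fun u => (g <= u)%MM)) /= addrC; congr (_ + _).
  rewrite mulr_suml; apply: eq_bigr => u gu.
  by rewrite -scalerAl -mpolyXD submK.
move=> /msuppD_le; rewrite mem_cat => /orP[/Ia /= ->|]; first by rewrite orbT.
move/msuppM_le/allpairsP=> [[v w] /= [_]]; rewrite msuppX inE => /eqP-> ->.
by rewrite lem_addl.
Qed.

Lemma mideal_mulX (k : fieldType) (m : nat) (gs : seq 'X_{1..m}) g
    (p : {mpoly k[m]}) :
  mideal gs ('X_[g] * p) <->
  forall u, u \in msupp p -> has (fun h => (h <= g + u)%MM) gs.
Proof.
rewrite mulrC; split=> Ip u.
  by move=> up; apply: Ip; rewrite (perm_mem (msuppMX _ _)) map_f.
by rewrite (perm_mem (msuppMX _ _)) => /mapP[v /Ip hv ->].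
Qed.

Lemma mideal_cone (k : fieldType) (m : nat) (gs hs : seq 'X_{1..m})
    (a b : 'X_{1..m}) (F : graded_free_resolution (@mideal k m gs))
    (G : graded_free_resolution (@mideal k m hs)) :
  (forall p, @mideal k m hs p -> mideal gs ('X_[a] * p)) ->
  (forall p, @mideal k m gs ('X_[a + b] * p) -> mideal hs p) ->
  (0 < mdeg b)%N -> minimal_resolution F -> minimal_resolution G ->
  exists C : graded_free_resolution (@mideal k m ((a + b)%MM :: gs)),
    [/\ minimal_resolution C, basis_count C 0 =1 basis_count F 0
      & forall i t, basis_count C i.+1 (t + (mdeg a + mdeg b)) =
          (basis_count F i.+1 (t + (mdeg a + mdeg b)) + basis_count G i t)%N /\
        ((t < mdeg a + mdeg b)%N -> basis_count C i.+1 t = basis_count F i.+1 t)].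
Proof.
rewrite mideal_cons mpolyXD => JI IJ b_gt0.
apply: cone_resolution => // [|u|u]; first exact: mideal_homogeneous.
  by rewrite msuppX inE => /eqP->.
by rewrite msuppX inE => /eqP->.
Qed.

(** * Colon ideals of path ideals *)

Fixpoint path_gens (m : nat) (y : nat -> 'X_{1..m}) (n : nat) : seq 'X_{1..m} :=
  if n is n'.+1 then (y n' + y n'.+1)%MM :: path_gens y n' else [::].

Lemma has_path_gens (m : nat) (y : nat -> 'X_{1..m}) n u :
  has (fun g => (g <= u)%MM) (path_gens y n) <->
  exists2 i, (i < n)%N & (y i + y i.+1 <= u)%MM.
Proof.
elim: n => [|n IHn] /=; first by split=> // -[].
split=> [/orP[yu|/IHn[i lt_in yu]]|[i]]; first by exists n.
  by exists i => //; apply: ltnW.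
rewrite ltnS leq_eqVlt => /orP[/eqP->|lt_in] yu; first by rewrite yu.
by apply/orP; right; apply/IHn; exists i.
Qed.

Definition disjoint_mnm (m : nat) (g h : 'X_{1..m}) : Prop :=
  forall v, g v = 0%N \/ h v = 0%N.

Lemma disjoint_mnmD (m : nat) (g h u : 'X_{1..m}) :
  disjoint_mnm g u -> disjoint_mnm h u -> disjoint_mnm (g + h)%MM u.
Proof. by move=> gu hu v; rewrite mnmDE; have := gu v; have := hu v; lia. Qed.

Lemma lem_disjoint (m : nat) (g h u : 'X_{1..m}) :
  disjoint_mnm g h -> (g <= h + u)%MM -> (g <= u)%MM.
Proof.
move=> gh /mnm_lepP le; apply/mnm_lepP => v; have := le v; rewrite mnmDE.
by have := gh v; lia.
Qed.

(** [y j] shares no variable with the generators, so it is a non-zero-divisor modulo them. *)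
Lemma path_colon_next (k : fieldType) (m : nat) (y : nat -> 'X_{1..m}) n j
    (p : {mpoly k[m]}) :
  (forall i, (i < n)%N -> disjoint_mnm (y i + y i.+1)%MM (y j)) ->
  mideal (path_gens y n) ('X_[y j] * p) -> mideal (path_gens y n) p.
Proof.
move=> dis /mideal_mulX Ip u /Ip/has_path_gens[i lt_in yu].
apply/has_path_gens; exists i => //; apply: lem_disjoint yu.
exact: dis.
Qed.

(** Generators with [i.+1 < r] share no variable with [y r.+1 + y r.+2], so they divide the other
    factor; the remaining ones, with [r = i] or [r = i.+1], contain [y r]. *)
Lemma path_colon_edge (k : fieldType) (m : nat) (y : nat -> 'X_{1..m}) r
    (p : {mpoly k[m]}) :
  (forall i j, (i < j <= r.+2)%N -> disjoint_mnm (y i) (y j)) ->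
  mideal (path_gens y r.+1) ('X_[y r.+1 + y r.+2] * p) ->
  mideal (y r :: path_gens y r.-1) p.
Proof.
move=> dis /mideal_mulX Ip u /Ip/has_path_gens[i lt_ir yu] /=.
have disr j l : (j <= r)%N -> (r < l <= r.+2)%N -> disjoint_mnm (y j) (y l).
  by move=> jr rl; apply: dis; lia.
have strip j : (j <= r)%N -> (y j <= y r.+1 + y r.+2 + u)%MM -> (y j <= u)%MM.
  move=> jr; rewrite -addmA => /lem_disjoint le.
  apply: (@lem_disjoint _ _ (y r.+2)); first by apply: disr; lia.
  by apply: le; apply: disr; lia.
have yi : (y i <= u)%MM.
  by apply: strip; [lia | apply: lepm_trans (lem_addr _ _) yu].
have [i_lt|i_ge] := ltnP i.+1 r.
  apply/orP; right; apply/has_path_gens; exists i; first lia.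
  have := yu; rewrite -addmA => /lem_disjoint le.
  apply: (@lem_disjoint _ _ (y r.+2)).
    by apply: disjoint_mnmD; apply: disr; lia.
  by apply: le; apply: disjoint_mnmD; apply: disr; lia.
apply/orP; left; have [->|i_eq] : r = i \/ r = i.+1 by lia.
  exact: yi.
by apply: strip => //; rewrite {1}i_eq; apply: lepm_trans (lem_addl _ _) yu.
Qed.

(** As [y r + y r.+1] is a generator, the factor [y r.+1] suffices, and [y r.+2] is kept to make the
    cone minimal. *)
Lemma path_edge_mul (k : fieldType) (m : nat) (y : nat -> 'X_{1..m}) r
    (p : {mpoly k[m]}) :
  mideal (y r :: path_gens y r.-1) p ->
  mideal (path_gens y r.+1) ('X_[y r.+1] * p).
Proof.
move=> Ip; apply/mideal_mulX => u /Ip /orP[yu|/has_path_gens[i lt_ir yu]];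
  apply/has_path_gens.
  exists r => //; apply/mnm_lepP => v; rewrite !mnmDE.
  by rewrite addnC leq_add2l; apply/mnm_lepP.
by exists i; [lia | apply: lepm_trans yu _; apply: lem_addl].
Qed.

(** * The recursion satisfied by the binomial formula *)

(* The Betti number of [R/I_n] in homological degree [l + s] and degree
   [(2 l + s) * alpha], so [l = j - i] and [s = 2 i - j].  The test guards against
   truncated subtraction. *)
Definition path_betti (n l s : nat) : nat :=
  if l is l'.+1 then
    if (l.*2 <= n.+1)%N then
      ('C(l, s) * 'C(n.+1 - l.*2, l) + 'C(l', s) * 'C(n.+1 - l.*2, l'))%N
    else 0%N
  else (s == 0%N).

Lemma path_betti0 l s : path_betti 0 l s = ((l == 0) && (s == 0))%N.
Proof. by case: l. Qed.

Lemma path_betti1 l s :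
  path_betti 1 l s =
  (path_betti 0 l s + if l is l'.+1 then path_betti 0 l' s else 0)%N.
Proof.
case: l => [|[|l]] //; first by rewrite addn0.
by case: s => [|s] //; rewrite /path_betti /= subnn bin0n muln0.
Qed.

(** This is Pascal's rule: for [l.+1], the binomials on the left with upper index depending on [r]
    have [A.+1] there, those on the right [A]. The terms in [r.-1] count the basis for
    [I_(r-1) + (y_r)]. *)
Lemma path_betti_rec r l s :
  path_betti r.+2 l s =
  (path_betti r.+1 l s +
   if l is l'.+1 then
     path_betti r.-1 l' s + if s is s'.+1 then path_betti r.-1 l' s' else 0
   else 0)%N.
Proof.
case: l => [|l]; first by rewrite addn0.
have Nrec n j : (n.+1 < l.+1.*2)%N -> path_betti n l.+1 j = 0%N.
  by move=> lt; rewrite /path_betti leqNgt lt.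
case: (leqP l.+1.*2 r.+2) => [le|gt]; last first.
  have -> : path_betti r.+2 l.+1 s = 0%N.
    rewrite /path_betti; case: leqP => // le.
    (* Here [l.+1.*2 = r.+3]: the upper index is 0 while the lower indices [l.+1] and [l] are
       positive. *)
    have -> : (r.+3 - l.+1.*2 = 0)%N by lia.
    by rewrite !bin0n; case: l gt le {Nrec} => [|l] //; lia.
  rewrite Nrec //; case: l gt {Nrec} => [|l] gt; first lia.
  have z j : path_betti r.-1 l.+1 j = 0%N.
    by rewrite /path_betti leqNgt (_ : r.-1.+1 < l.+1.*2)%N //; lia.
  by case: s => [|s]; rewrite !z.
rewrite {1 2}/path_betti le (leqW le) subSn //; set A := (r.+2 - l.+1.*2)%N.
(* For [l = 0] the terms in [r.-1] fall under the separate first branch of [path_betti]. *)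
case: l le @A {Nrec} => [|l] le A.
  rewrite /path_betti !bin1 bin0.
  case: s => [|[|s]]; rewrite ?bin0 ?bin1 ?bin0n /=; try lia.
  by rewrite (@bin_small 1 s.+2).
have -> : path_betti r.-1 l.+1 =
    fun j => ('C(l.+1, j) * 'C(A, l.+1) + 'C(l, j) * 'C(A, l))%N.
  apply: functional_extensionality => j; rewrite /path_betti ifT; last lia.
  by rewrite (_ : r.-1.+1 - l.+1.*2 = A)%N // /A; lia.
rewrite !(binS A); case: s => [|s]; first by rewrite !bin0; ring.
by rewrite (binS l.+1) (binS l); ring.
Qed.

(** * Bidegrees in cones and the resolution of a path ideal *)

(* [f i t] is zero outside the points [(i, t) = (l + s, (2 l + s) * alpha)],
   where its value is [c l s]. *)
Definition supported_by (alpha : nat) (f c : nat -> nat -> nat) : Prop :=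
  (forall l s, f (l + s)%N ((l.*2 + s) * alpha)%N = c l s) /\
  (forall i t, f i t <> 0%N ->
     exists l s, i = (l + s)%N /\ t = ((l.*2 + s) * alpha)%N).

Lemma supported_by_vanish (alpha : nat) (f c : nat -> nat -> nat) i j :
  (0 < alpha)%N -> supported_by alpha f c -> ~~ (i <= j <= i.*2)%N ->
  f i (j * alpha)%N = 0%N.
Proof.
move=> a_gt0 [_ fs] ij; case: (f i (j * alpha)%N =P 0%N) => // /fs[l [s [iE /eqP]]].
by rewrite eqn_pmul2r // => /eqP jE; lia.
Qed.

(** A cone over an element of degree [alpha] raises the homological degree by 1 and the degree by
    [alpha], which moves [(l, s)] to [(l, s.+1)]. *)
Lemma supported_by_linear (alpha : nat) (f g h c c' : nat -> nat -> nat) :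
  (0 < alpha)%N -> supported_by alpha f c -> supported_by alpha g c' ->
  (forall t, h 0%N t = f 0%N t) ->
  (forall i t, h i.+1 (t + alpha)%N = (f i.+1 (t + alpha) + g i t)%N /\
     ((t < alpha)%N -> h i.+1 t = f i.+1 t)) ->
  supported_by alpha h
    (fun l s => c l s + if s is s'.+1 then c' l s' else 0)%N.
Proof.
move=> a_gt0 fc gc h0 hS; split=> [l [|s]|i t].
- rewrite [RHS]addn0 -(proj1 fc) !addn0; case: l => [|l]; first exact: h0.
  (* The contribution of [g] would be at [i = l] and [j = l.*2.+1], above [i.*2]. *)
  have -> : (l.+1.*2 * alpha = l.*2.+1 * alpha + alpha)%N by lia.
  by rewrite (proj1 (hS _ _)) (supported_by_vanish a_gt0 gc) ?addn0 //; lia.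
- rewrite -(proj1 fc) -(proj1 gc).
  have -> : ((l.*2 + s.+1) * alpha = (l.*2 + s) * alpha + alpha)%N by lia.
  by rewrite !addnS (proj1 (hS _ _)).
- case: i => [|i]; first by rewrite h0; apply: (proj2 fc).
  have [t_lt|t_ge] := ltnP t alpha.
    by rewrite (proj2 (hS _ _)) //; apply: (proj2 fc).
  rewrite -(subnK t_ge) (proj1 (hS _ _)) => nz.
  have [g0|/eqP/(proj2 gc)[l [s [-> ->]]]] := eqVneq (g i (t - alpha)%N) 0%N.
    by apply: (proj2 fc); rewrite g0 addn0 in nz.
  by exists l, s.+1; split; lia.
Qed.

(** The degree now rises by [2 alpha], which moves [(l, s)] to [(l.+1, s)]. *)
Lemma supported_by_edge (alpha : nat) (f g h c c' : nat -> nat -> nat) :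
  (0 < alpha)%N -> supported_by alpha f c -> supported_by alpha g c' ->
  (forall t, h 0%N t = f 0%N t) ->
  (forall i t, h i.+1 (t + (alpha + alpha))%N =
      (f i.+1 (t + (alpha + alpha)) + g i t)%N /\
     ((t < alpha + alpha)%N -> h i.+1 t = f i.+1 t)) ->
  supported_by alpha h
    (fun l s => c l s + if l is l'.+1 then c' l' s else 0)%N.
Proof.
move=> a_gt0 fc gc h0 hS; split=> [[|l] s|i t].
- rewrite [RHS]addn0 -(proj1 fc); case: s => [|[|s]]; first exact: h0.
    by rewrite (proj2 (hS _ _)) //; lia.
  (* The contribution of [g] would be at [i = s.+1] and [j = s], below [i]. *)
  have -> : ((0.*2 + s.+2) * alpha = s * alpha + (alpha + alpha))%N by lia.
  by rewrite (proj1 (hS _ _)) (supported_by_vanish a_gt0 gc) ?addn0 //; lia.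
- rewrite -(proj1 fc) -(proj1 gc).
  have -> : ((l.+1.*2 + s) * alpha = (l.*2 + s) * alpha + (alpha + alpha))%N by lia.
  by rewrite (proj1 (hS _ _)).
- case: i => [|i]; first by rewrite h0; apply: (proj2 fc).
  have [t_lt|t_ge] := ltnP t (alpha + alpha).
    by rewrite (proj2 (hS _ _)) //; apply: (proj2 fc).
  rewrite -(subnK t_ge) (proj1 (hS _ _)) => nz.
  have [g0|/eqP/(proj2 gc)[l [s [-> ->]]]] :=
    eqVneq (g i (t - (alpha + alpha))%N) 0%N.
    by apply: (proj2 fc); rewrite g0 addn0 in nz.
  by exists l.+1, s; split; lia.
Qed.

Lemma path_resolution (k : fieldType) (m N alpha : nat) (y : nat -> 'X_{1..m}) :
  (0 < alpha)%N -> (forall i, (i <= N)%N -> mdeg (y i) = alpha) ->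
  (forall i j, (i < j <= N)%N -> disjoint_mnm (y i) (y j)) ->
  forall n, (n <= N)%N ->
  exists F : graded_free_resolution (@mideal k m (path_gens y n)),
    minimal_resolution F /\ supported_by alpha (basis_count F) (path_betti n).
Proof.
move=> a_gt0 ydeg ydis; elim/ltn_ind => n IHn nN.
have [Z [Zmin Zc]] : exists F : graded_free_resolution (@mideal k m [::]),
    minimal_resolution F /\ supported_by alpha (basis_count F) (path_betti 0).
  rewrite mideal0; have [Z [Zmin Zc]] := zero_ideal_resolution k m.
  exists Z; split=> //; split=> [l s|i t]; rewrite Zc.
    by rewrite path_betti0; case: l s => [|l] [|s].
  case: i t => [|i] [|t] //= _; by exists 0%N, 0%N.
case: n IHn nN => [|[|r]] IHn nN; first by exists Z.
(* For [n = 1] the cone is that of a non-zero monomial acting on the ring, a domain. *)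
- have [||||//|C [Cmin C0 CS]] := @mideal_cone _ _ _ _ (y 0%N) (y 1%N) Z Z.
  + by move=> p; rewrite mideal0 => ->; rewrite mulr0.
  + rewrite mideal0 => p /eqP; rewrite mulf_eq0 => /orP[|/eqP//].
    move/eqP/(congr1 (mcoeff (y 0%N + y 1%N)%MM)); rewrite mcoeffX mcoeff0 eqxx.
    by move/eqP; rewrite oner_eq0.
  + by rewrite ydeg.
  + done.
  exists C; split=> //; rewrite !ydeg // in CS.
  have := supported_by_edge a_gt0 Zc Zc C0 CS.
  congr (supported_by _ _ _); apply: functional_extensionality => l.
  by apply: functional_extensionality => s; rewrite path_betti1.
(* For [r = 0] the truncated [r.-1] still gives the right ideal, which is zero. *)
have [||G [Gmin Gc]] := IHn r.-1; [lia | lia |].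
have [||F [Fmin Fc]] := IHn r.+1; [lia | lia |].
(* [K] resolves the quotient by the colon ideal; its first factor is 1 and its second the
   non-zero-divisor [y r]. *)
have [|||//|//|K [Kmin K0 KS]] := @mideal_cone _ _ _ _ 0%MM (y r) G G.
- by move=> p; rewrite mpolyX0 mul1r.
- by move=> p; rewrite add0m; apply: path_colon_next => i ir;
    apply: disjoint_mnmD; apply: ydis; lia.
- by rewrite ydeg //; lia.
have Kc := supported_by_linear a_gt0 Gc Gc K0.
rewrite mdeg0 !ydeg ?add0n in KS; [|lia..].
move/(_ KS) in Kc; rewrite add0m in K Kmin K0 KS Kc.
have [|||//|//|C [Cmin C0 CS]] := @mideal_cone _ _ _ _ (y r.+1) (y r.+2) F K.
- exact: path_edge_mul.
- by move=> p; apply: path_colon_edge => i j ij; apply: ydis; lia.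
- by rewrite ydeg.
exists C; split=> //; rewrite !ydeg ?(ltnW nN) // in CS.
have := supported_by_edge a_gt0 Fc Kc C0 CS.
congr (supported_by _ _ _); apply: functional_extensionality => l.
by apply: functional_extensionality => s; rewrite path_betti_rec.
Qed.

(** * Squarefree monomials and edge ideals *)

Definition set_mnm (V : finType) (F : {set V}) : 'X_{1..#|V|} :=
  (\sum_(v in F) U_(enum_rank v))%MM.

Lemma xprodE (k : fieldType) (V : finType) (F : {set V}) :
  xprod k F = 'X_[set_mnm F].
Proof.
rewrite /xprod /set_mnm (big_morph _ (@mpolyXD _ k) (mpolyX0 _ k)).
by [].
Qed.

Lemma set_mnmE (V : finType) (F : {set V}) j : set_mnm F j = (enum_val j \in F).
Proof.
rewrite /set_mnm mnm_sumE -[RHS]/(nat_of_bool _).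
rewrite (eq_bigr (fun v => (v == enum_val j) : nat)) => [|v _]; last first.
  by rewrite mnm1E -(inj_eq enum_val_inj) enum_rankK.
have [jF|jF] := boolP (enum_val j \in F).
  rewrite (bigD1 _ jF) /= eqxx big1 ?addn0 // => v /andP[_ /negPf->] //.
by rewrite big1 // => v vF; case: eqP jF vF => // -> /negPf->.
Qed.

Lemma mdeg_set_mnm (V : finType) (F : {set V}) : mdeg (set_mnm F) = #|F|.
Proof.
rewrite /set_mnm mdeg_sum -(sum1_card (mem F)); apply: eq_bigr => v _.
by rewrite mdeg1.
Qed.

Lemma set_mnm_disjoint (V : finType) (F G : {set V}) :
  [disjoint F & G] -> disjoint_mnm (set_mnm F) (set_mnm G).
Proof.
move=> FG v; rewrite !set_mnmE; case: (boolP (_ \in F)) => [/(disjointFr FG)->|_].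
  by right.
by left.
Qed.

Lemma set_mnmU (V : finType) (F G : {set V}) :
  [disjoint F & G] -> set_mnm (F :|: G) = (set_mnm F + set_mnm G)%MM.
Proof.
move=> FG; apply/mnmP => j; rewrite mnmDE !set_mnmE inE.
by case: (boolP (_ \in F)) => [/(disjointFr FG)->|_].
Qed.

(** Distinct indices let the coefficients be collected into one function, as [edge_ideal]
    requires. *)
Lemma mideal_sum (k : fieldType) (m : nat) (T : eqType) (s : seq T)
    (g : T -> 'X_{1..m}) (p : {mpoly k[m]}) :
  uniq s -> mideal (map g s) p ->
  exists c : T -> {mpoly k[m]}, p = \sum_(x <- s) c x * 'X_[g x].
Proof.
elim: s p => [|x s IHs] p /=.
  by rewrite mideal0 => _ ->; exists (fun _ => 0); rewrite big_nil.
case/andP=> xNs us; rewrite mideal_cons => -[a [b [/(IHs _ us)[c ->] ->]]].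
exists (fun z => if z == x then b else c z); rewrite big_cons eqxx addrC.
congr (_ + _); apply: eq_big_seq => z zs.
by case: eqP xNs zs => // -> /negPf->.
Qed.

Lemma edge_idealE (k : fieldType) (V : finType) (H : {set {set V}}) :
  edge_ideal (k := k) H = mideal [seq set_mnm F | F <- enum H].
Proof.
apply: functional_extensionality => p; apply: propositional_extensionality.
split=> [[c ->]|/(mideal_sum (enum_uniq _))[c ->]]; last first.
  by exists c; rewrite big_enum; apply: eq_bigr => F _; rewrite xprodE.
have hI := mideal_homogeneous k [seq set_mnm F | F <- enum H].
apply: (ideal_sum _ hI) => F FH; rewrite xprodE.
case: hI => _ _ mulI _; apply: mulI; rewrite -[X in mideal _ X]scale1r.
apply: mideal_monomial; apply/hasP; exists (set_mnm F); last exact: lepm_refl.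
by rewrite map_f ?mem_enum.
Qed.

Lemma mem_path_gens (m : nat) (y : nat -> 'X_{1..m}) n g :
  g \in path_gens y n <-> exists2 i, (i < n)%N & g = (y i + y i.+1)%MM.
Proof.
elim: n => [|n IHn] /=; first by split=> // -[].
rewrite in_cons; split=> [/orP[/eqP->|/IHn[i lt_in ->]]|[i]]; first by exists n.
  by exists i => //; apply: ltnW.
rewrite ltnS leq_eqVlt => /orP[/eqP->|lt_in] gE; first by rewrite gE eqxx.
by apply/orP; right; apply/IHn; exists i.
Qed.

(** * The blocks of a line hypergraph *)

(** Take for [A 0] half of the first edge, avoiding the second, and for [A i.+1] the rest of the
    edge [i]. As [d = 2 alpha], comparing sizes shows that this rest is the overlap with the next
    edge, if there is one. *)
Lemma line_hypergraph_blocks (V : finType) (n alpha : nat) (H : {set {set V}}) :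
  line_hypergraph n (2 * alpha) alpha H ->
  (0 < alpha)%N /\
  exists A : nat -> {set V},
    [/\ forall i, (i <= n)%N -> #|A i| = alpha,
        forall i j, (i < j <= n)%N -> [disjoint A i & A j]
      & forall F, F \in H <-> exists2 i, (i < n)%N & F = A i :|: A i.+1].
Proof.
case=> n_gt0 [H2 _] Hd [E [_ HE _ adj cardI]].
(* Edges out of range are empty, so the edge after the last one makes sense. *)
pose E' i := if insub i is Some j then E j else set0.
have E'E (j : 'I_n) : E' j = E j by rewrite /E' valK.
have E'out i : (n <= i)%N -> E' i = set0.
  by move=> le; rewrite /E'; case: insubP => // j; rewrite ltnNge le.
have EH (j : 'I_n) : E j \in H by rewrite HE imset_f.
have cardE i : (i < n)%N -> #|E' i| = (2 * alpha)%N.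
  by move=> lt; rewrite (E'E (Ordinal lt)) Hd.
have cardEI i : (i.+1 < n)%N -> #|E' i :&: E' i.+1| = alpha.
  move=> lt; rewrite (E'E (Ordinal lt)) (E'E (Ordinal (ltnW lt))).
  exact: cardI.
have far i j : (i.+1 < j)%N -> [disjoint E' i & E' j].
  move=> ij; have [jn|/E'out->] := ltnP j n; last by rewrite -setI_eq0 setI0.
  have lt_in : (i < n)%N by lia.
  rewrite (E'E (Ordinal jn)) (E'E (Ordinal lt_in)) -setI_eq0.
  apply/negPn/negP => nz.
  have [|/(_ nz)] := adj (Ordinal lt_in) (Ordinal jn).
    by apply/eqP => /(congr1 val) /=; lia.
  by case=> /=; lia.
have a_gt0 : (0 < alpha)%N.
  by have := H2 _ (EH (Ordinal n_gt0)); rewrite Hd //; lia.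
split=> //.
(* With several edges the difference has exactly [alpha] vertices; with one edge it has [2 * alpha],
   and any [alpha] of them serve. *)
have [s [us ss sub]] : exists s,
    [/\ uniq s, size s = alpha & {subset s <= E' 0%N :\: E' 1%N}].
  apply/card_geqP; rewrite cardsD cardE //.
  have [n1|/E'out->] := ltnP 1 n; first by rewrite cardEI //; lia.
  by rewrite setI0 cards0; lia.
pose A := fix A i := if i is i'.+1 then E' i' :\: A i' else [set x in s].
have inv i : (i < n)%N ->
    [/\ A i \subset E' i, #|A i| = alpha & [disjoint A i & E' i.+1]].
  elim: i => [|i IHi] lt_in.
    have sA : A 0%N \subset E' 0%N :\: E' 1%N.
      by apply/subsetP => x; rewrite inE => /sub.
    split; first by apply: subset_trans sA (subsetDl _ _).
      by rewrite /A cardsE; apply/eqP; rewrite -ss; apply/eqP/card_uniqP.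
    by move: sA; rewrite subsetD => /andP[].
  have [sA cA dA] := IHi (ltnW lt_in).
  (* The intersection avoids [A i], so it lies in [E' i :\: A i], and both have [alpha] elements. *)
  have AE : A i.+1 = E' i :&: E' i.+1.
    apply/esym/eqP; rewrite eqEcard; apply/andP; split.
      rewrite /= subsetD subsetIl /=.
      by apply: disjointWl (subsetIr _ _) _; rewrite disjoint_sym.
    by rewrite cardEI //= cardsD (setIidPr sA) cA cardE; lia.
  split; first by rewrite AE subsetIr.
    by rewrite AE cardEI.
  by rewrite AE; apply: disjointWl (subsetIl _ _) _; apply: far.
have subS i : A i.+1 \subset E' i by apply: subsetDl.
exists A; split=> [[|i] le_in|i j /andP[ij jn]|F].
- by have [] := inv 0%N n_gt0.
- by have [sA cA _] := inv i le_in; rewrite /= cardsD (setIidPr sA) cA cardE; lia.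
- case: j ij jn => // j ij jn; have [sA cA dA] := inv i (leq_trans ij jn).
  (* The later block is now [A j.+1], inside [E' j]: this edge is [E' i] itself, or the next one,
     which avoids [A i], or one disjoint from [E' i]. *)
  have [->|[->|ij2]] : j = i \/ j = i.+1 \/ (i.+1 < j)%N by lia.
  + by rewrite disjoint_sym disjoints_subset /= setDE subsetIr.
  + exact: disjointWr (subS _) dA.
  + by apply: disjointWl sA _; apply: disjointWr (subS _) _; apply: far.
- have EA i : (i < n)%N -> A i :|: A i.+1 = E' i.
    by move=> lt; have [sA _ _] := inv i lt; rewrite /= -{1}(setIidPr sA) setID.
  rewrite HE; split=> [/imsetP[j _ ->]|[i lt ->]].
    by exists j => //; rewrite EA.
  by rewrite EA // (E'E (Ordinal lt)) imset_f.
Qed.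

(** * Integer binomials and the final formula *)

Lemma binz_nat (a b : nat) : binz a%:Z b%:Z = 'C(a, b).
Proof.
by rewrite /binz lez_nat /=; case: leqP => // /bin_small->.
Qed.

Lemma binz_neg (a b : int) : (a < 0)%R -> binz a b = 0%N.
Proof. by rewrite /binz; case: ifP => //; lia. Qed.

(** The guard in [path_betti] matches the vanishing of [binz] at a negative upper index, which also
    removes the second product when [l = 0]. *)
Lemma path_betti_binz (n l s : nat) :
  path_betti n l s =
  (binz l%:Z s%:Z * binz (n%:Z + 1 - 2%:Z * l%:Z) l%:Z +
   binz (l%:Z - 1) s%:Z * binz (n%:Z + 1 - 2%:Z * l%:Z) (l%:Z - 1))%N.
Proof.
case: l => [|l].
  rewrite [X in (_ + X * _)%N]binz_neg // addn0.
  have -> : (n%:Z + 1 - 2%:Z * 0%N%:Z)%R = n.+1%:Z by lia.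
  by rewrite !binz_nat bin0 muln1; case: s.
have -> : (l.+1%:Z - 1)%R = l%:Z by lia.
rewrite /path_betti; case: (leqP l.+1.*2 n.+1) => le; last first.
  by rewrite !(@binz_neg (_ - _)) ?muln0 //; lia.
have -> : (n%:Z + 1 - 2%:Z * l.+1%:Z)%R = (n.+1 - l.+1.*2)%N%:Z by lia.
by rewrite !binz_nat.
Qed.

Theorem theorem3p8 (k : fieldType) (V : finType) (n d alpha : nat)
  (H : {set {set V}}) (HL : line_hypergraph n d alpha H)
  (Hd : d = (2 * alpha)%N) :
  (forall i t : nat, betti (edge_ideal (k := k) H) i t <> 0%N ->
     exists j : nat, t = (j * alpha)%N /\ (j <= 2 * i)%N) /\
  (forall i j : nat, (j <= 2 * i)%N ->
     betti (edge_ideal (k := k) H) i (j * alpha) =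
       (binz (j%:Z - i%:Z) (2%:Z * i%:Z - j%:Z) *
          binz (n%:Z + 1 - 2%:Z * j%:Z + 2%:Z * i%:Z) (j%:Z - i%:Z) +
        binz (j%:Z - i%:Z - 1) (2%:Z * i%:Z - j%:Z) *
          binz (n%:Z + 1 - 2%:Z * j%:Z + 2%:Z * i%:Z) (j%:Z - i%:Z - 1))%N).
Proof.
rewrite Hd in HL; have [a_gt0 [A [cardA disA HA]]] := line_hypergraph_blocks HL.
pose y i := set_mnm (A i).
have ydeg i : (i <= n)%N -> mdeg (y i) = alpha by rewrite mdeg_set_mnm => /cardA.
have ydis i j : (i < j <= n)%N -> disjoint_mnm (y i) (y j).
  by move=> ij; apply: set_mnm_disjoint; apply: disA.
have -> : edge_ideal (k := k) H = mideal (path_gens y n).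
  rewrite edge_idealE; apply: functional_extensionality => p.
  apply: propositional_extensionality.
  have eq_gens : [seq set_mnm F | F <- enum H] =i path_gens y n.
    have yU i : (i < n)%N -> set_mnm (A i :|: A i.+1) = (y i + y i.+1)%MM.
      by move=> lt; rewrite set_mnmU // disA // ltnSn.
    move=> g; apply/mapP/idP => [[F]|/mem_path_gens[i lt ->]].
      rewrite mem_enum => /HA[i lt ->] ->; apply/mem_path_gens.
      by exists i; rewrite ?yU.
    by exists (A i :|: A i.+1); rewrite ?yU // mem_enum; apply/HA; exists i.
  by split=> Ip u /Ip; rewrite (eq_has_r eq_gens).
have [F [Fmin Fc]] := path_resolution k a_gt0 ydeg ydis (leqnn n).
have bettiE i t : betti (@mideal k _ (path_gens y n)) i t = basis_count F i t.
  rewrite (betti_homology_dim F); last exact: mideal_homogeneous.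
  exact: homology_dim_minimal.
split=> [i t|i j ij]; rewrite bettiE.
  by move/(proj2 Fc) => [l [s [-> ->]]]; exists (l.*2 + s)%N; split=> //; lia.
(* For [j < i] the point is outside the support, and the upper indices [j - i] and [j - i - 1] are
   negative. *)
have [le_ij|lt_ji] := leqP i j; last first.
  rewrite (supported_by_vanish a_gt0 Fc); last lia.
  by rewrite !(@binz_neg (_ - _)) //; lia.
(* With [l = j - i] and [s = 2 i - j] one has [l + s = i] and [2 l + s = j]. *)
have -> : (j%:Z - i%:Z)%R = (j - i)%N%:Z by lia.
have -> : (2%:Z * i%:Z - j%:Z)%R = (i.*2 - j)%N%:Z by lia.
have -> : (n%:Z + 1 - 2%:Z * j%:Z + 2%:Z * i%:Z)%R =
    (n%:Z + 1 - 2%:Z * (j - i)%N%:Z)%R by lia.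
rewrite -path_betti_binz -(proj1 Fc); congr (basis_count _ _ (_ * _)); lia.
Qed.
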